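(* Let $p\ge 3$ be an odd integer and let $\lambda\ge\lambda_p$ be a real number. Then the map $f_{p,\lambda}\colon[0,1]\to[0,1]$ (constructed in the context) is topologically mixing.
   Context: For odd $p\ge 3$, $\lambda_p$ denotes the unique positive root of $X^p-2X^{p-2}-1$; one has $\lambda_p>\sqrt2>1$. Construction of $f=f_{p,\lambda}$. Fix an odd integer $p\ge 3$ and a real $\lambda\ge\lambda_p$. Set $x_{p-1}:=1$, $x_{p-2}:=0$, $x_{p-3}:=\frac1\lambda$ and, for every integer $i$ with $0\le i\le p-4$ (no such $i$ if $p=3$), $$x_i:=\frac{(-1)^i}{\lambda^{p-i-2}}\sum_{j=0}^{p-i-3}(-\lambda)^j .$$ Set $$t:=1-\frac{x_0}{\lambda}=\frac{1}{\lambda^{p-1}}\Bigl(\lambda^{p-1}-\sum_{j=0}^{p-3}(-\lambda)^j\Bigr).$$ These points satisfy $x_{i+1}=1-\lambda x_i$ for $0\le i\le p-4$, $x_0=\lambda(1-t)$, and are ordered as $$0=x_{p-2}<x_{p-4}<\cdots<x_1<x_0<x_2<x_4<\cdots<x_{p-3}=\tfrac1\lambda\le t<x_{p-1}=1$$ (for $p=3$: $0=x_1<x_0=\frac1\lambda\le t<x_2=1$). Let $s:=x_{p-4}$ if $p\ge 5$ and $s:=1$ if $p=3$. The map $f\colon[0,1]\to[0,1]$ is the continuous map defined by: - $f(x):=1-\lambda x$ for $x\in[0,\frac1\lambda]$; - $f(x):=\lambda(x-t)$ for $x\in[t,1]$; - if $t>\frac1\lambda$, put $\ell:=t-\frac1\lambda$,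 $k:=\lfloor\frac{\lambda\ell}{2s}\rfloor$, $J_i:=[\frac1\lambda+(i-1)\frac{2s}{\lambda},\frac1\lambda+i\frac{2s}{\lambda}]$ for $1\le i\le k$, and $K:=[\frac1\lambda+k\frac{2s}{\lambda},t]$ (possibly $k=0$, or $K=\{t\}$). On each $J=J_1,\ldots,J_k,K$, $f$ is the tent map that vanishes at both endpoints of $J$, is affine of slope $\lambda$ on the left half of $J$ and affine of slope $-\lambda$ on the right half of $J$ (so $f$ has maximum value $s$ on each $J_i$, and maximum value $<s$ on $K$). With this definition, $f(x_i)=x_{i+1}$ for $0\le i\le p-2$ and $f(x_{p-1})=x_0$. *)

(* Defs.v *)
From HB Require Import structures.
From mathcomp Require Import all_boot all_order all_algebra.
From mathcomp Require Import all_classical all_reals all_analysis.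
From mathcomp Require Import ring lra zify.

Set Implicit Arguments.
Unset Strict Implicit.
Unset Printing Implicit Defensive.

Import Order.TTheory GRing.Theory Num.Theory.
Import numFieldNormedType.Exports.

Local Open Scope classical_set_scope.
Local Open Scope ring_scope.

Definition topologically_mixing (T : topologicalType) (f : T -> T) : Prop :=
  forall U V : set T, open U -> U !=set0 -> open V -> V !=set0 ->
  exists N : nat, forall n : nat, (N <= n)%N ->
    (iter n f @` U) `&` V !=set0.

(* As a type, [unit_itv R] carries the topology induced by that of [R]. *)
Definition unit_itv (R : realType) : set R := `[0, 1]%classic.
Arguments unit_itv : clear implicits.

Definition lambda_poly (R : realType) (p : nat) : {poly R} :=
  'X^p - 2%:P * 'X^(p - 2) - 1.

(* The default value 0 of [xget] is never used when 3 <= p: see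
   [lambda_pP] and [lambda_p_uniq]. *)
Definition lambda_p (R : realType) (p : nat) : R :=
  xget 0 [set x : R | 0 < x /\ root (lambda_poly R p) x].

Definition x_ (R : realType) (p : nat) (lam : R) (i : nat) : R :=
  if i == (p - 1)%N then 1
  else if i == (p - 2)%N then 0
  else if i == (p - 3)%N then lam^-1
  else (-1) ^+ i / lam ^+ (p - i - 2)
       * \sum_(0 <= j < (p - i - 3).+1) (- lam) ^+ j.

Definition t_ (R : realType) (p : nat) (lam : R) : R := 1 - x_ p lam 0 / lam.

Definition s_ (R : realType) (p : nat) (lam : R) : R :=
  if p == 3 then 1 else x_ p lam (p - 4).

Definition nb_J (R : realType) (p : nat) (lam : R) : nat :=
  Num.truncn (lam * (t_ p lam - lam^-1) / (2 * s_ p lam)).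

(* For 1 <= i <= k, J_i is [[endJ p lam (i - 1), endJ p lam i]]; K is
   [[endJ p lam k, t]]. *)
Definition endJ (R : realType) (p : nat) (lam : R) (i : nat) : R :=
  lam^-1 + i%:R * (2 * s_ p lam / lam).

Definition tent (R : realType) (lam a b x : R) : R :=
  if x <= (a + b) / 2 then lam * (x - a) else lam * (b - x).

(* The formula for f_{p,lambda}, on the whole of [R]. The index [i : 'I_k]
   stands for the interval J_(i+1). Where two consecutive pieces meet, both
   take the value 0. *)
Definition f_fun (R : realType) (p : nat) (lam x : R) : R :=
  if x <= lam^-1 then 1 - lam * x
  else if t_ p lam <= x then lam * (x - t_ p lam)
  else if [pick i : 'I_(nb_J p lam)
             | x \in `[endJ p lam i, endJ p lam i.+1]%R] is Some i
  then tent lam (endJ p lam i) (endJ p lam i.+1) x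
  else tent lam (endJ p lam (nb_J p lam)) (t_ p lam) x.

Section WellDefined.
Variable R : realType.
Implicit Types (p : nat) (lam x : R).

Lemma root_lambda_poly p x : (3 <= p)%N ->
  root (lambda_poly R p) x = (x ^+ (p - 2) * (x ^+ 2 - 2) == 1).
Proof.
move=> p3; rewrite rootE /lambda_poly !hornerE.
rewrite -[in RHS]subr_eq0; congr (_ == 0).
by rewrite mulrBr -exprD subnK ?[2 * _]mulrC //; lia.
Qed.

Lemma root_lambda_gt p x : (3 <= p)%N -> 0 < x -> root (lambda_poly R p) x ->
  2 < x ^+ 2.
Proof.
move=> p3 x0; rewrite root_lambda_poly // => /eqP e.
by rewrite -subr_gt0 -(pmulr_rgt0 _ (exprn_gt0 (p - 2) x0)) e ltr01.
Qed.

Lemma lambda_p_exists p : (3 <= p)%N ->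
  exists x : R, 0 < x /\ root (lambda_poly R p) x.
Proof.
move=> p3.
have [||x] := @poly_ivt R (lambda_poly R p) 0 2.
- exact: ler0n.
- have e : 2 ^+ p = 2 ^+ 2 * 2 ^+ (p - 2) :> R.
    by rewrite -exprD; congr (_ ^+ _); lia.
  have : 1 <= 2 ^+ (p - 2) :> R by rewrite exprn_ege1 // ler1n.
  rewrite /lambda_poly !hornerE !expr0n e.
  have -> : (p == 0)%N = false by lia.
  have -> : (p - 2 == 0)%N = false by lia.
  by move: (2 ^+ (p - 2)) => A /=; lra.
- move=> /andP[x0 _] rx; exists x; split => //.
  rewrite lt_neqAle x0 andbT eq_sym; apply/eqP => xE.
  move: rx; rewrite root_lambda_poly // xE expr0n.
  rewrite (_ : (p - 2 == 0)%N = false) ?mul0r 1?eq_sym ?oner_eq0 //; lia.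
Qed.

Lemma lambda_pP p : (3 <= p)%N ->
  0 < lambda_p R p /\ root (lambda_poly R p) (lambda_p R p).
Proof.
move=> /lambda_p_exists[x xP].
exact: (@xgetPex _ 0 [set x : R | 0 < x /\ root (lambda_poly R p) x]
                 (ex_intro _ x xP)).
Qed.

Lemma lambda_p_uniq p x : (3 <= p)%N -> 0 < x -> root (lambda_poly R p) x ->
  x = lambda_p R p.
Proof.
move=> p3; have [] := lambda_pP p3; move: (lambda_p R p) => y.
have lt_root (u v : R) : 0 < u -> 0 < v -> root (lambda_poly R p) u ->
    root (lambda_poly R p) v -> ~ (u < v).
  move=> u0 v0 ru rv uv; have u2 := root_lambda_gt p3 u0 ru.
  move: ru rv; rewrite !root_lambda_poly // => /eqP uE /eqP vE.
  suff : u ^+ (p - 2) * (u ^+ 2 - 2) < v ^+ (p - 2) * (v ^+ 2 - 2).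
    by rewrite uE vE ltxx.
  apply: ltr_pM; rewrite ?exprn_ge0 ?(ltW u0) ?subr_ge0 ?(ltW u2) //.
    by rewrite ltrXn2r ?(ltW u0) ?(ltW v0) //; lia.
  by rewrite ltrD2r ltrXn2r ?(ltW u0) ?(ltW v0).
move=> y0 ry x0 rx.
by case: (ltgtP x y) => // [/(lt_root _ _ x0 y0 rx ry)|
                            /(lt_root _ _ y0 x0 ry rx)].
Qed.

Lemma lambda_p_gt1 p : (3 <= p)%N -> 1 < lambda_p R p.
Proof.
move=> p3; have [l0 rl] := lambda_pP p3.
by have := root_lambda_gt p3 l0 rl; nra.
Qed.

Lemma x0_le1 p lam : odd p -> (3 <= p)%N -> 1 < lam -> x_ p lam 0 <= 1.
Proof.
move=> op p3 l1; have l0 : 0 < lam by exact: lt_trans l1.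
rewrite /x_; have -> : (0%N == (p - 1)%N) = false by lia.
have -> : (0%N == (p - 2)%N) = false by lia.
case: ifPn => [_|pn3]; first by rewrite invf_le1 // ltW.
rewrite expr0 div1r subn0 mulrC ler_pdivrMr ?exprn_gt0 // mul1r.
have -> : (p - 3).+1 = (p - 2)%N by lia.
have := subrX1 (- lam) (p - 2); rewrite big_mkord.
have -> : (- lam) ^+ (p - 2) = - lam ^+ (p - 2).
  by rewrite exprNn -signr_odd oddB ?op ?expr1 ?mulN1r //; lia.
have : 1 <= lam ^+ (p - 2) by rewrite exprn_ege1 // ltW.
by move: (lam ^+ _) (\sum_(_ < _) _) => A S; nra.
Qed.

Lemma s_itv p lam : odd p -> (3 <= p)%N -> 1 < lam ->
  0 < s_ p lam <= 1.
Proof.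
move=> op p3 l1; have l0 : 0 < lam by exact: lt_trans l1.
rewrite /s_; case: eqP => [_|pn3]; first by rewrite ltr01 lexx.
have p5 : (5 <= p)%N by move: op pn3; case: p p3 => [|[|[|[|[|]]]]].
rewrite /x_; have -> : ((p - 4)%N == (p - 1)%N) = false by lia.
have -> : ((p - 4)%N == (p - 2)%N) = false by lia.
have -> : ((p - 4)%N == (p - 3)%N) = false by lia.
have -> : (p - (p - 4) - 2 = 2)%N by lia.
have -> : (p - (p - 4) - 3 = 1)%N by lia.
rewrite -signr_odd oddB ?op //= ?expr1; last by lia.
rewrite big_mkord !big_ord_recl big_ord0 expr0 addr0 /= expr1.
have -> : -1 / lam ^+ 2 * (1 - lam) = (lam - 1) / lam ^+ 2.
  by field; rewrite gt_eqF.
apply/andP; split; first by rewrite divr_gt0 ?exprn_gt0 // subr_gt0.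
by rewrite ler_pdivrMr ?exprn_gt0 //; nra.
Qed.

Lemma f_fun_itv p lam : odd p -> (3 <= p)%N -> 1 < lam ->
  forall x, unit_itv R x -> unit_itv R (f_fun p lam x).
Proof.
move=> op p3 l1 x; rewrite /unit_itv /= !in_itv /= => /andP[x0 x1].
have l0 : 0 < lam by exact: lt_trans l1.
have lv : lam * lam^-1 = 1 by rewrite mulfV // gt_eqF.
have /andP[s0 s1] := s_itv op p3 l1.
have X0 := x0_le1 op p3 l1.
rewrite /f_fun; case: (leP x lam^-1) => [xl|lx].
  have : lam * x <= lam * lam^-1 by rewrite ler_pM2l.
  by rewrite lv; nra.
case: (leP (t_ p lam) x) => [tx|xt].
  apply/andP; split; first by rewrite mulr_ge0 ?(ltW l0) ?subr_ge0.
  have : lam * (x - t_ p lam) <= lam * (1 - t_ p lam).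
    by rewrite ler_pM2l // lerD2r.
  suff -> : lam * (1 - t_ p lam) = x_ p lam 0 by move=> /le_trans; apply.
  by rewrite /t_; field; rewrite gt_eqF.
have tentP a b : a <= x -> x <= b -> lam * (b - a) <= 2 ->
    0 <= tent lam a b x <= 1.
  move=> ax xb ab; rewrite /tent; case: (leP x ((a + b) / 2)) => h.
    apply/andP; split; first by rewrite mulr_ge0 ?(ltW l0) ?subr_ge0.
    have : lam * (x - a) <= lam * ((b - a) / 2) by rewrite ler_pM2l //; lra.
    by rewrite mulrA; lra.
  apply/andP; split; first by rewrite mulr_ge0 ?(ltW l0) ?subr_ge0.
  have : lam * (b - x) <= lam * ((b - a) / 2) by rewrite ler_pM2l //; lra.
  by rewrite mulrA; lra.
case: pickP => [i|noJ].
  rewrite in_itv /= => /andP[ax xb]; apply: tentP => //.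
  have -> : lam * (endJ p lam i.+1 - endJ p lam i) = 2 * s_ p lam.
    by rewrite /endJ -natr1; field; rewrite gt_eqF.
  lra.
have endJ_le n : (n <= nb_J p lam)%N -> endJ p lam n <= x.
  elim: n => [_|n IHn nk]; first by rewrite /endJ mul0r addr0 ltW.
  have := noJ (Ordinal nk); rewrite in_itv /= IHn 1?ltnW //=.
  by move/negbT; rewrite -ltNge => /ltW.
apply: tentP; [exact: endJ_le|exact: ltW|].
have : 0 <= lam * (t_ p lam - lam^-1) / (2 * s_ p lam).
  by rewrite !mulr_ge0 ?invr_ge0 ?mulr_ge0 ?(ltW l0) ?(ltW s0) //; lra.
move=> /truncn_itv/andP[_]; rewrite -/(nb_J p lam).
rewrite ltr_pdivrMr ?mulr_gt0 // => ub.
rewrite /endJ; set n := nb_J p lam in ub *.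
have -> : lam * (t_ p lam - (lam^-1 + n%:R * (2 * s_ p lam / lam)))
   = lam * (t_ p lam - lam^-1) - n%:R * (2 * s_ p lam).
  by field; rewrite gt_eqF.
by move: ub; rewrite -natr1; lra.
Qed.

Lemma f_map_subproof p lam : (3 <= p)%N -> odd p -> lambda_p R p <= lam ->
  forall x, unit_itv R x -> unit_itv R (f_fun p lam x).
Proof.
move=> p3 op hlam; apply: f_fun_itv => //.
exact: lt_le_trans (lambda_p_gt1 p3) hlam.
Qed.

End WellDefined.

Definition f_map (R : realType) (p : nat) (lam : R)
    (p_ge3 : (3 <= p)%N) (p_odd : odd p) (le_lam : lambda_p R p <= lam)
    (x : unit_itv R) : unit_itv R :=
  SigSub (mem_set (f_map_subproof p_ge3 p_odd le_lam (set_valP x))).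

(* Main.v *)
Require Import Defs.
From mathcomp Require Import all_boot all_order all_algebra.
From mathcomp Require Import all_classical all_reals all_analysis.
From mathcomp Require Import ring lra zify.

(* All slopes of f are at least sqrt 2 in absolute value.  An interval contained
   in one monotone piece is stretched by lam; one contained in a single tent
   is stretched by at least lam / 2, which suffices if lam > 2, while if
   lam <= 2 the tents are so low that their image lies in [0, 1/lam], where
   the next iterate stretches by lam again: two steps stretch by
   lam^2 / 2 > 1.  So the iterates of any interval eventually meet an interior
   zero of f, hence cover some [0, e].  As 0 lies on the periodic orbit of the
   x_i, the iterates of [0, e] are one-sided neighbourhoods of these points
   that grow until they cover a whole [0, x_i] with i even, and these
   intervals successively cover [0, x_(i+2)], ..., [0, 1/lam] and [0, 1]. *)

Import Order.TTheory GRing.Theory Num.Theory.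
Import numFieldNormedType.Exports.
Local Open Scope classical_set_scope.
Local Open Scope ring_scope.

(** * Covering [0, 1] by iterates, reasoned backwards along affine pieces *)

Definition eventually_onto {R : realType} (f : R -> R) (A : set R) : Prop :=
  exists n : nat, `[0, 1] `<=` iter n f @` A.

Section EventuallyOnto.
Context {R : realType} {f : R -> R} {lam : R}.
Hypothesis lam_gt0 : 0 < lam.

Lemma eventually_onto_sub {A B : set R} :
  eventually_onto f B -> B `<=` A -> eventually_onto f A.
Proof.
move=> [n onB] BA; exists n; apply: subset_trans onB _.
exact: image_subset.
Qed.

Lemma eventually_onto_preimage {A B : set R} :
  eventually_onto f B -> B `<=` f @` A -> eventually_onto f A.
Proof.
move=> [n onB] BA; exists n.+1 => y /onB[_ /BA[x Ax <-] <-].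
by exists x => //; rewrite iterSr.
Qed.

Lemma decreasing_piece_onto {a b d : R} :
  (forall x, a <= x <= b -> f x = lam * (d - x)) ->
  `[lam * (d - b), lam * (d - a)] `<=` f @` `[a, b].
Proof.
move=> fE y; rewrite /= in_itv /= => /andP[y1 y2].
have ab : a <= d - y / lam <= b.
  by rewrite lerBrDr -lerBrDl ler_pdivrMr // mulrC y2 lerBlDr -lerBlDl
             ler_pdivlMr // mulrC.
exists (d - y / lam); first by rewrite /= in_itv.
by rewrite fE //; field; rewrite gt_eqF.
Qed.

Lemma increasing_piece_onto {a b c : R} :
  (forall x, a <= x <= b -> f x = lam * (x - c)) ->
  `[lam * (a - c), lam * (b - c)] `<=` f @` `[a, b].
Proof.
move=> fE y; rewrite /= in_itv /= => /andP[y1 y2].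
have ab : a <= c + y / lam <= b.
  by rewrite -lerBlDl ler_pdivlMr // mulrC y1 -lerBrDl ler_pdivrMr // mulrC.
exists (c + y / lam); first by rewrite /= in_itv.
by rewrite fE //; field; rewrite gt_eqF.
Qed.

Lemma eventually_onto_decreasing {a b} d {a' b' : R} :
  (forall x, a <= x <= b -> f x = lam * (d - x)) ->
  lam * (d - b) <= a' -> b' <= lam * (d - a) ->
  eventually_onto f `[a', b'] -> eventually_onto f `[a, b].
Proof.
move=> fE ha hb /eventually_onto_preimage; apply.
apply: subset_trans (decreasing_piece_onto fE).
by apply: subset_itv; rewrite bnd_simp.
Qed.

Lemma eventually_onto_increasing {a b} c {a' b' : R} :
  (forall x, a <= x <= b -> f x = lam * (x - c)) ->
  lam * (a - c) <= a' -> b' <= lam * (b - c) ->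
  eventually_onto f `[a', b'] -> eventually_onto f `[a, b].
Proof.
move=> fE ha hb /eventually_onto_preimage; apply.
apply: subset_trans (increasing_piece_onto fE).
by apply: subset_itv; rewrite bnd_simp.
Qed.

Lemma eventually_onto_itv {a b a' b' : R} : a <= a' -> b' <= b ->
  eventually_onto f `[a', b'] -> eventually_onto f `[a, b].
Proof.
move=> ha hb /eventually_onto_sub; apply.
by apply: subset_itv; rewrite bnd_simp.
Qed.

End EventuallyOnto.

(* The backward orbit of 0 under x |-> 1 - lam x: the paper's x_i is
   [preorbit lam (p - 2 - i)]. *)
Definition preorbit {R : realType} (lam : R) (m : nat) : R :=
  (1 - (- lam^-1) ^+ m) / (1 + lam).

(** * The periodic orbit through 0 in closed form *)

Section Orbit.
Context {R : realType} {lam : R}.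
Hypothesis lam_gt1 : 1 < lam.

Let lam0 : 0 < lam. Proof. exact: lt_trans lam_gt1. Qed.
Let lam_neq0 : lam != 0. Proof. by rewrite gt_eqF. Qed.
Let lam1_neq0 : 1 + lam != 0. Proof. by rewrite gt_eqF // addr_gt0. Qed.

Lemma preorbitS m : 1 - lam * preorbit lam m.+1 = preorbit lam m.
Proof.
by rewrite /preorbit exprS; field; apply/andP.
Qed.

Lemma preorbit1 : preorbit lam 1 = lam^-1.
Proof. by rewrite /preorbit expr1; field; apply/andP. Qed.

Lemma preorbit_ge0 m : 0 <= preorbit lam m.
Proof.
rewrite /preorbit divr_ge0 ?(addr_ge0 _ (ltW lam0)) //.
rewrite subr_ge0 (le_trans (ler_norm _)) // normrX normrN normfV gtr0_norm //.
by rewrite exprn_ile1 ?invr_ge0 ?(ltW lam0) // invf_le1 // ltW.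
Qed.

Lemma preorbit_le m : preorbit lam m.+1 <= lam^-1.
Proof.
have := preorbit_ge0 m; rewrite -preorbitS subr_ge0 => h.
by rewrite -[leRHS]mul1r ler_pdivlMr // mulrC.
Qed.

Lemma x_0E p : odd p -> (3 <= p)%N -> x_ p lam 0 = preorbit lam (p - 2).
Proof.
move=> op p3; rewrite /x_; have -> : (0%N == (p - 1)%N) = false by lia.
have -> : (0%N == (p - 2)%N) = false by lia.
case: ifPn => [e|_]; first by rewrite (_ : (p - 2 = 1)%N) ?preorbit1 //; lia.
have e : (p - 3).+1 = (p - 2)%N by lia.
rewrite expr0 div1r subn0 e /preorbit big_mkord.
have om : odd (p - 2) by rewrite oddB ?op //; lia.
have XN (x : R) : (- x) ^+ (p - 2) = - x ^+ (p - 2).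
  by rewrite exprNn -signr_odd om expr1 mulN1r.
have := subrX1 (- lam) (p - 2).
rewrite !XN exprVn.
have : 0 < lam ^+ (p - 2) by rewrite exprn_gt0.
move: (lam ^+ _) (\sum_(_ < _) _) => A S A0 h.
(* [S] is the geometric sum of ratio [- lam] with [p - 2] terms, an odd number. *)
have -> : S = (A + 1) / (1 + lam).
  apply: (mulfI (_ : lam + 1 != 0)); first by rewrite addrC.
  transitivity (A + 1); first by lra.
  by field.
by field; apply/andP; split; rewrite // gt_eqF.
Qed.

End Orbit.

(** After n steps the size is at least [q ^+ n * e], which passes [B] since [q ^+ n] dominates
    [n%:R * (q - 1)]. The step allows every [e'] above [q * e], so that larger gains are accepted as
    well. *)
Lemma expansion_ind {R : realType} {P : R -> Prop} {q B : R} : 1 < q ->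
  (forall e, B <= e -> P e) ->
  (forall e, 0 < e -> (forall e', q * e <= e' -> P e') -> P e) ->
  forall e, 0 < e -> P e.
Proof.
move=> q1 PB step.
have q0 : 0 < q by exact: lt_trans q1.
have pow n : n%:R * (q - 1) <= q ^+ n.
  elim: n => [|n IHn]; first by rewrite mul0r.
  have : 1 <= q ^+ n by rewrite exprn_ege1 // ltW.
  by rewrite -natr1 exprS; nra.
have P_of n : forall e, 0 < e -> B <= q ^+ n * e -> P e.
  elim: n => [|n IHn] e e0; first by rewrite mul1r; apply: PB.
  move=> Be; apply: step => // e' he'; apply: IHn.
    by apply: lt_le_trans he'; rewrite mulr_gt0.
  apply: le_trans Be _; rewrite exprSr -mulrA ler_pM2l ?exprn_gt0 //.
move=> e e0; have qe0 : 0 < (q - 1) * e by rewrite mulr_gt0 // subr_gt0.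
have := archi_boundP (normr_ge0 (B / ((q - 1) * e))).
set N := Num.Def.archi_bound _ => hN; apply: (P_of N) => //.
have {hN} : B / ((q - 1) * e) <= N%:R by rewrite (le_trans (ler_norm _)) ?ltW.
rewrite ler_pdivrMr // mulrA => /le_trans; apply.
by rewrite ler_pM2r.
Qed.

(** * Growth of intervals under an abstract map with the branches of f *)

Section Expansion.
Context {R : realType} {f : R -> R} {lam t : R} {m0 : nat}.
Hypotheses (lam_gt1 : 1 < lam) (lam_sqr : 2 < lam ^+ 2).
Hypothesis f_itv : forall x : R, 0 <= x <= 1 -> 0 <= f x <= 1.
Hypothesis f_left : forall x, x <= lam^-1 -> f x = lam * (lam^-1 - x).
Hypothesis f_right : forall x, t <= x -> f x = lam * (x - t).
Hypothesis f_tent : forall x, lam^-1 <= x < t -> exists c d,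
  [/\ lam^-1 <= c <= x, x < d <= t
    & forall y, c <= y <= d -> f y = tent lam c d y].
Hypotheses (m0_odd : odd m0) (tE : lam * (1 - t) = preorbit lam m0).

Let lam0 : 0 < lam. Proof. exact: lt_trans lam_gt1. Qed.
Let lamV : lam * lam^-1 = 1. Proof. by rewrite mulfV // gt_eqF. Qed.
Let lamV0 : 0 < lam^-1. Proof. by rewrite invr_gt0. Qed.
Let lamV1 : lam^-1 < 1. Proof. by rewrite invf_lt1. Qed.
Let t_le1 : t <= 1.
Proof.
by rewrite -subr_ge0 -(pmulr_rge0 _ lam0) tE; apply: preorbit_ge0.
Qed.

Let onto := eventually_onto f.

Lemma onto_left {a b a' b'} : b <= lam^-1 ->
  1 - lam * b <= a' -> b' <= 1 - lam * a ->
  onto `[a', b'] -> onto `[a, b].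
Proof.
move=> b1 ha hb; apply: (eventually_onto_decreasing lam0 lam^-1).
- by move=> x /andP[_ xb]; apply: f_left; apply: le_trans b1.
- by rewrite mulrBr lamV.
- by rewrite mulrBr lamV.
Qed.

Lemma onto_right {a b a' b'} : t <= a ->
  lam * (a - t) <= a' -> b' <= lam * (b - t) ->
  onto `[a', b'] -> onto `[a, b].
Proof.
move=> ta ha hb; apply: (eventually_onto_increasing lam0 t) => //.
by move=> x /andP[ax _]; apply: f_right; apply: le_trans ax.
Qed.

Lemma onto_laminv {a b} : a <= 0 -> lam^-1 <= b -> onto `[a, b].
Proof.
move=> a0 b1; apply: (eventually_onto_itv a0 b1).
apply: (@onto_left 0 lam^-1 0 1) => //; first by rewrite lamV subrr.
  by rewrite mulr0 subr0.
by exists 0%N => x xI; exists x.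
Qed.

(** Write u_m for [preorbit lam m]. Two steps lower the index by two: [0, u_(m+2)] maps onto
    [u_(m+1), 1], whose part up to the turning point 1/lam maps onto [0, u_m]. The descent ends at
    u_1 = 1/lam. *)
Lemma onto_preorbit m : odd m -> onto `[0, preorbit lam m].
Proof.
move: m; apply: (@ltn_ind (fun m => odd m -> onto _)) => -[|[|m]] IH //= om.
  by rewrite preorbit1 //; apply: onto_laminv.
have u1 := preorbit_ge0 lam_gt1 m.+1.
apply: (@onto_left _ _ (preorbit lam m.+1) lam^-1).
- exact: preorbit_le.
- by rewrite preorbitS.
- by rewrite mulr0 subr0 ltW.
- apply: (onto_left (lexx _) _ _ (IH m _ _)) => //.
    by rewrite lamV subrr.
  + by rewrite preorbitS.
  + by move: om; rewrite negbK.
Qed.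

(* A one-sided neighbourhood of a point of the periodic orbit through 0 is
   carried along that orbit to a neighbourhood of 0, unless it meets a
   turning point before. *)
Lemma onto_preorbit_nbhd {m d} : odd m -> 0 < d <= preorbit lam m ->
  (forall d', lam * d <= d' -> onto `[0, d']) ->
  onto `[preorbit lam m - d, preorbit lam m].
Proof.
move: m d; apply: (@ltn_ind (fun m => forall d, odd m -> _ -> _ -> onto _)).
move=> -[|[|m]] IH d //= om /andP[d0 du] H.
  rewrite preorbit1 // in du *.
  apply: (onto_left (lexx _) _ _ (H (lam * d) (lexx _))) => //.
    by rewrite lamV subrr.
  by rewrite mulrBr lamV; lra.
have u1 := preorbit_ge0 lam_gt1 m.+1.
have u2 := preorbit_le lam_gt1 m.
have uE := preorbitS lam_gt1 m.
have uE' := preorbitS lam_gt1 m.+1.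
have om' : odd m by move: om; rewrite negbK.
set u := preorbit lam m.+2 in du u2 uE' *.
apply: (@onto_left _ _ (preorbit lam m.+1) (preorbit lam m.+1 + lam * d)).
- exact: preorbit_le.
- by rewrite uE'.
- by rewrite mulrBr; lra.
(* If the image reaches the turning point, it contains [u_(m+1), 1/lam], which maps onto [0, u_m];
   otherwise a second step gives the same situation at u_m with [lam ^+ 2 * d]. *)
have [le|lt] := leP lam^-1 (preorbit lam m.+1 + lam * d).
  apply: (eventually_onto_itv (lexx _) le).
  apply: (onto_left (lexx _) _ _ (onto_preorbit m om')).
    by rewrite lamV subrr.
  by rewrite uE.
apply: (@onto_left _ _ (preorbit lam m - lam ^+ 2 * d) (preorbit lam m)).
- exact: ltW.
- by rewrite -uE; lra.
- by rewrite uE.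
apply: IH => //.
  rewrite mulr_gt0 ?exprn_gt0 //= -uE.
  by move: lt; rewrite -(ltr_pM2l lam0) lamV; lra.
move=> d' hd'; apply: H; apply: le_trans hd'.
by rewrite ler_pM2l // ler_peMl ?(ltW d0) // exprn_ege1 // ltW.
Qed.

(** [0, e] goes to a left neighbourhood of 1, then of x_0. Either it covers [t, 1], hence [0, x_0],
    on the way, or a full turn along the orbit multiplies its length by at least lam^3, more than
    the factor [lam] required. *)
Lemma onto_nbhd0 {e} : 0 < e -> onto `[0, e].
Proof.
move: e; apply: (@expansion_ind _ (fun e => onto `[0, e]) _ lam^-1 lam_gt1)
  => [e he|e e0 H].
  exact: onto_laminv.
have [/onto_laminv|el] := leP lam^-1 e; first by apply.
have el' : lam * e < 1 by rewrite -lamV ltr_pM2l.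
apply: (@onto_left _ _ (1 - lam * e) 1); rewrite ?mulr0 ?subr0 //.
  exact: ltW.
have [et|te] := leP (1 - lam * e) t.
  apply: (eventually_onto_itv et (lexx _)).
  apply: (onto_right (lexx _) _ _ (onto_preorbit m0 m0_odd)).
    by rewrite subrr mulr0.
  by rewrite tE.
apply: (@onto_right _ _ (preorbit lam m0 - lam * (lam * e)) (preorbit lam m0)).
- exact: ltW.
- by rewrite -tE; lra.
- by rewrite tE.
apply: onto_preorbit_nbhd => //.
  rewrite !mulr_gt0 //= -tE ler_pM2l //; lra.
move=> e' he'; apply: H; apply: le_trans he'.
by rewrite ler_pM2l // mulrA ler_peMl ?mulr_ege1 // ltW.
Qed.

Lemma tent_left {c d y : R} : y <= (c + d) / 2 ->
  tent lam c d y = lam * (y - c).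
Proof. by rewrite /tent => ->. Qed.

Lemma tent_right {c d y : R} : (c + d) / 2 <= y ->
  tent lam c d y = lam * (d - y).
Proof.
move=> h2; rewrite /tent; case: (leP y _) => // h1.
have -> : y = (c + d) / 2 by apply/le_anti; rewrite h1 h2.
by field.
Qed.

(* A tent of base at most 1 - 1/lam has height at most (lam - 1) / 2, which
   is at most 1/lam when lam <= 2. *)
Lemma tent_le {c d y : R} : lam <= 2 -> lam^-1 <= c -> d <= 1 ->
  tent lam c d y <= lam^-1.
Proof.
move=> lam2 hc hd.
have h : lam * ((d - c) / 2) <= lam^-1.
  have : lam * ((d - c) / 2) <= lam * ((1 - lam^-1) / 2).
    by rewrite ler_pM2l //; lra.
  have -> : lam * ((1 - lam^-1) / 2) = (lam - 1) / 2.
    by rewrite mulrA mulrBr mulr1 lamV.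
  have ? : 0 <= (2 - lam) * (lam - 1) by rewrite mulr_ge0 ?subr_ge0 // ltW.
  have : (lam - 1) / 2 <= lam^-1 by rewrite -(ler_pM2l lam0) lamV; lra.
  lra.
rewrite /tent; case: (leP y _) => hy; apply: le_trans h;
  rewrite ler_pM2l //; lra.
Qed.

Lemma onto_itv {a b : R} : 0 <= a -> a < b -> b <= 1 -> onto `[a, b].
Proof.
(* [q] is the worst gain, met inside a tent; a piece of slope [lam] gains at least as much by
   [q_lam]. *)
pose q := if lam <= 2 then lam ^+ 2 / 2 else lam / 2.
have q1 : 1 < q.
  by rewrite /q; case: ifPn; rewrite -?ltNge ltr_pdivlMr // mul1r.
have q_lam : q <= lam.
  rewrite /q; case: ifPn => [lam2|_]; last by have := lam0; lra.
  by rewrite ler_pdivrMr // expr2 ler_pM2l.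
suff H e : 0 < e -> forall a b : R, 0 <= a -> b <= 1 -> e = b - a ->
    onto `[a, b].
  by move=> a0 ab b1; apply: (H (b - a)) => //; rewrite subr_gt0.
(* The bound 2 makes the base case vacuous: no interval in [0, 1] is that long. *)
move: e {a b}; apply: (expansion_ind q1 (B := 2))
  => [e he a b|e e0 IH a b] a0 b1 eE.
  lra.
have {}IH a' b' : 0 <= a' -> b' <= 1 -> q * (b - a) <= b' - a' ->
    onto `[a', b'].
  by move=> *; apply: (IH (b' - a')) => //; rewrite eE.
have f_le1 x : a <= x <= b -> f x <= 1.
  move=> /andP[ax xb]; have /f_itv/andP[] // : 0 <= x <= 1.
  by rewrite (le_trans a0) ?(le_trans xb).
have le_q : q * (b - a) <= lam * (b - a) by rewrite ler_pM2r // -eE.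
have [al|la] := ltP a lam^-1.
  have [bl|lb] := leP b lam^-1.
    apply: (onto_left bl (lexx _) (lexx _)); apply: IH.
    - by rewrite subr_ge0 -lamV ler_pM2l.
    - by rewrite gerBl mulr_ge0 // ltW.
    - by move: le_q; lra.
  apply: (eventually_onto_itv (lexx _) (ltW lb)).
  apply: (@onto_left _ _ 0 (1 - lam * a)) => //; first by rewrite lamV subrr.
  by apply: onto_nbhd0; rewrite subr_gt0 -lamV ltr_pM2l.
have [ta|at_] := leP t a.
  apply: (onto_right ta (lexx _) (lexx _)); apply: IH.
  - by rewrite mulr_ge0 ?subr_ge0 // ltW.
  - by rewrite -f_right ?f_le1 ?lexx ?andbT //; lra.
  - by move: le_q; lra.
have /f_tent[c [d [/andP[hc ca] /andP[ad dt] fE]]] : lam^-1 <= a < t.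
  by rewrite la at_.
have d1 : d <= 1 by apply: le_trans dt t_le1.
(* If [d < b], the zero [d] is interior: [a'] lies on the decreasing half of the tent, so [a', d]
   covers some [0, e]. *)
have [db|bd] := ltP d b.
  pose a' := Num.max a ((c + d) / 2).
  have [aa' ha'] : a <= a' /\ (c + d) / 2 <= a'.
    by rewrite /a' !le_max !lexx orbT.
  have a'd : a' < d by rewrite /a' gt_max ad /=; lra.
  apply: (eventually_onto_itv aa' (ltW db)).
  apply: (@eventually_onto_decreasing _ _ _ lam0 _ _ d 0 (lam * (d - a')))
    => //.
  - move=> x /andP[x1 x2]; rewrite fE ?tent_right //; first exact: le_trans x1.
    by apply/andP; split=> //; lra.
  - by rewrite subrr mulr0.
  - by apply: onto_nbhd0; rewrite mulr_gt0 // subr_gt0.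
(* Half of [a, b] lies in one monotone piece of the tent. *)
suff [a' [b' [a'0 b'1 len onto']]] : exists a' b',
  [/\ 0 <= a', b' <= (if lam <= 2 then lam^-1 else 1),
      lam * ((b - a) / 2) <= b' - a'
    & onto `[a', b'] -> onto `[a, b]].
  apply: onto'; move: b'1 IH; rewrite /q; case: ifPn => lam2 b'1 IH.
    apply: (onto_left b'1 (lexx _) (lexx _)); apply: IH.
    - by rewrite subr_ge0 -lamV ler_pM2l.
    - by rewrite gerBl mulr_ge0 // ltW.
    - have : lam * (lam * ((b - a) / 2)) <= lam * (b' - a') by rewrite ler_pM2l.
      by rewrite expr2; lra.
  by apply: IH => //; lra.
have f_le x : a <= x <= b -> f x <= (if lam <= 2 then lam^-1 else 1).
  move=> /andP[x1 x2]; case: ifP => [lam2|_].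
    by rewrite fE ?tent_le //; apply/andP; split; lra.
  by rewrite f_le1 // x1 x2.
(* The side of the apex on which the midpoint of [a, b] falls decides which half to keep. *)
have [hm|hm] := leP ((a + b) / 2) ((c + d) / 2).
  pose m := (a + b) / 2.
  have fm x : a <= x <= m -> f x = lam * (x - c).
    rewrite /m => /andP[x1 x2].
    by rewrite fE ?tent_left //; try (apply/andP; split); lra.
  exists (lam * (a - c)), (lam * (m - c)); split.
  - by rewrite mulr_ge0 ?subr_ge0 // ltW.
  - by rewrite -fm ?f_le //; apply/andP; split; rewrite /m; lra.
  - by rewrite /m; lra.
  - move=> h; apply: (@eventually_onto_itv _ _ _ _ a m) => //.
      by rewrite /m; lra.
    exact: (eventually_onto_increasing lam0 c fm (lexx _) (lexx _) h).
pose m := (a + b) / 2.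
have fm x : m <= x <= b -> f x = lam * (d - x).
  rewrite /m => /andP[x1 x2].
  by rewrite fE ?tent_right //; try (apply/andP; split); lra.
exists (lam * (d - b)), (lam * (d - m)); split.
- by rewrite mulr_ge0 ?subr_ge0 // ltW.
- by rewrite -fm ?f_le //; apply/andP; split; rewrite /m; lra.
- by rewrite /m; lra.
- move=> h; apply: (@eventually_onto_itv _ _ _ _ m b) => //.
    by rewrite /m; lra.
  exact: (eventually_onto_decreasing lam0 d fm (lexx _) (lexx _) h).
Qed.

End Expansion.

(** * The branches of the concrete map *)

Section TheMap.
Context {R : realType} {p : nat} {lam : R}.
Hypotheses (p_ge3 : (3 <= p)%N) (p_odd : odd p).
Hypothesis le_lam : lambda_p R p <= lam.

Let lam_gt1 : 1 < lam.
Proof. exact: lt_le_trans (lambda_p_gt1 R p_ge3) le_lam. Qed.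
Let lam0 : 0 < lam. Proof. exact: lt_trans lam_gt1. Qed.
Let lamV : lam * lam^-1 = 1. Proof. by rewrite mulfV // gt_eqF. Qed.
Let m_odd : odd (p - 2). Proof. by rewrite oddB ?p_odd // ltnW. Qed.
Let s_gt0 : 0 < s_ p lam. Proof. by case/andP: (s_itv p_odd p_ge3 lam_gt1). Qed.

Lemma lam_sqr_gt2 : 2 < lam ^+ 2.
Proof.
have [l0 rl] := lambda_pP R p_ge3.
apply: lt_le_trans (root_lambda_gt p_ge3 l0 rl) _.
by rewrite lerXn2r // nnegrE ltW.
Qed.

(** Equality holds at [lambda_p R p], and both factors are nonnegative and nondecreasing from there
    on. *)
Lemma lam_above_root : 1 <= lam ^+ (p - 2) * (lam ^+ 2 - 2).
Proof.
have [l0 rl] := lambda_pP R p_ge3.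
move: (rl); rewrite root_lambda_poly // => /eqP e.
rewrite -[leLHS]e; have ? := ltW (root_lambda_gt p_ge3 l0 rl).
apply: ler_pM; rewrite ?exprn_ge0 ?subr_ge0 ?lerD2r ?(ltW l0) //;
  by rewrite lerXn2r // nnegrE ltW.
Qed.

Lemma t_E : lam * (1 - t_ p lam) = preorbit lam (p - 2).
Proof.
by rewrite -x_0E // /t_; field; rewrite gt_eqF.
Qed.

(** Clearing denominators turns the inequality into [lam_above_root]. *)
Lemma laminv_le_t : lam^-1 <= t_ p lam.
Proof.
rewrite -(ler_pM2l lam0) lamV.
have -> : lam * t_ p lam = lam - preorbit lam (p - 2) by rewrite -t_E; ring.
rewrite lerBrDr addrC -lerBrDr /preorbit.
have -> : (- lam^-1) ^+ (p - 2) = - (lam ^+ (p - 2))^-1.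
  by rewrite exprNn -signr_odd m_odd expr1 mulN1r exprVn.
have := lam_above_root; set A := lam ^+ (p - 2) => hA.
have A0 : 0 < A by rewrite exprn_gt0.
rewrite ler_pdivrMr ?addr_gt0 // -(ler_pM2l A0) opprK mulrDr mulfV ?gt_eqF //.
by move: hA; lra.
Qed.

Lemma f_funE_left x : x <= lam^-1 -> f_fun p lam x = lam * (lam^-1 - x).
Proof. by rewrite /f_fun => ->; rewrite mulrBr lamV. Qed.

Lemma f_funE_right x : t_ p lam <= x -> f_fun p lam x = lam * (x - t_ p lam).
Proof.
(* The left branch is tested first; the two overlap only if x = t = 1/lam, where both vanish. *)
move=> tx; have [xl|lx] := leP x lam^-1; last first.
  by rewrite /f_fun leNgt lx tx.
have tl := laminv_le_t.
have -> : t_ p lam = x by lra.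
by rewrite f_funE_left // (_ : lam^-1 = x) //; lra.
Qed.

Lemma ler_endJ i j : (endJ p lam i <= endJ p lam j) = (i <= j)%N.
Proof.
by rewrite /endJ lerD2l ler_pM2r ?ler_nat // divr_gt0 ?mulr_gt0.
Qed.

(** The hypotheses force y = b = c, where both tents vanish; hence the interval returned by [pick]
    does not matter. *)
Lemma tent_overlap {a b c d y : R} : a <= y <= b -> c <= y <= d -> b <= c ->
  tent lam a b y = tent lam c d y.
Proof.
move=> /andP[ay yb] /andP[cy yd] bc.
have yE : y = b by lra.
have cE : c = y by lra.
rewrite -yE cE in ay yd *.
by rewrite tent_right ?tent_left ?subrr ?mulr0 //; lra.
Qed.

Lemma endJ_nb_le_t : endJ p lam (nb_J p lam) <= t_ p lam.
Proof.
have tl := laminv_le_t.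
have : 0 <= lam * (t_ p lam - lam^-1) / (2 * s_ p lam).
  by rewrite divr_ge0 ?mulr_ge0 ?subr_ge0 ?(ltW lam0) ?(ltW s_gt0).
move=> /truncn_itv/andP[+ _]; rewrite -/(nb_J p lam).
rewrite ler_pdivlMr ?mulr_gt0 // /endJ => h.
by rewrite -lerBrDl mulrA ler_pdivrMr // [leRHS]mulrC.
Qed.

Lemma f_funE_piece {c d y} : lam^-1 <= c -> d <= t_ p lam -> c <= y <= d ->
  (forall i, (i < nb_J p lam)%N -> endJ p lam i <= y <= endJ p lam i.+1 ->
    tent lam (endJ p lam i) (endJ p lam i.+1) y = tent lam c d y) ->
  ((forall i, (i < nb_J p lam)%N ->
      ~~ (endJ p lam i <= y <= endJ p lam i.+1)) ->
    tent lam (endJ p lam (nb_J p lam)) (t_ p lam) y = tent lam c d y) ->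
  f_fun p lam y = tent lam c d y.
Proof.
move=> lc dt /andP[cy yd] HJ HK; rewrite /f_fun.
case: leP => [yl|_].
  have -> : c = y by lra.
  have <- : lam^-1 = y by lra.
  by rewrite tent_left ?subrr ?lamV ?mulr0 ?subrr //; lra.
case: leP => [ty|_].
  have -> : d = y by lra.
  have -> : t_ p lam = y by lra.
  by rewrite tent_right ?subrr //; lra.
case: pickP => [i|noJ]; first by rewrite in_itv; apply: HJ.
by apply: HK => i ik; have := noJ (Ordinal ik); rewrite in_itv /= => ->.
Qed.

(** At a common endpoint of two tents the right one is taken, so that [x < d] and an interval
    starting at [x] enters it. *)
Lemma f_fun_tent x : lam^-1 <= x < t_ p lam -> exists c d,
  [/\ lam^-1 <= c <= x, x < d <= t_ p lam
    & forall y, c <= y <= d -> f_fun p lam y = tent lam c d y].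
Proof.
move=> /andP[lx xt]; set k := nb_J p lam.
have J0 : endJ p lam 0 = lam^-1 by rewrite /endJ mul0r addr0.
have Jk := endJ_nb_le_t.
have [kx|xk] := leP (endJ p lam k) x.
  exists (endJ p lam k), (t_ p lam); split; rewrite ?xt ?lexx ?kx ?andbT //.
    by rewrite -J0 ler_endJ.
  move=> y yK; apply: f_funE_piece => //; first by rewrite -J0 ler_endJ.
  by move=> i ik yi; apply: tent_overlap; rewrite ?ler_endJ.
have [n nP nmin] := ex_minnP (ex_intro (fun n => x < endJ p lam n) k xk).
case: n nP nmin => [|n] nP nmin; first by move: nP; rewrite J0; lra.
have nk : (n < k)%N by apply: nmin.
have nx : endJ p lam n <= x.
  by rewrite leNgt; apply/negP => /nmin; rewrite ltnn.
have Jt : endJ p lam n.+1 <= t_ p lam by apply: le_trans Jk; rewrite ler_endJ.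
have lJ : lam^-1 <= endJ p lam n by rewrite -J0 ler_endJ.
exists (endJ p lam n), (endJ p lam n.+1); split; rewrite ?nP ?lJ //.
move=> y yJ; apply: f_funE_piece => //; last by move=> /(_ n nk); rewrite yJ.
move=> i ik yi; case: (ltngtP i n) => [lt|lt|-> //].
  by apply: tent_overlap; rewrite ?ler_endJ.
by apply/esym/tent_overlap; rewrite ?ler_endJ.
Qed.

Lemma f_fun_onto_itv {a b : R} : 0 <= a -> a < b -> b <= 1 ->
  eventually_onto (f_fun p lam) `[a, b].
Proof.
apply: (onto_itv lam_gt1 lam_sqr_gt2 _ f_funE_left f_funE_right f_fun_tent
  _ t_E).
- by move=> x; have := f_fun_itv p_odd p_ge3 lam_gt1 (x := x);
    rewrite /unit_itv /= !in_itv.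
- exact: m_odd.
Qed.

(** The left branch alone is onto; this keeps [0, 1] covered at all later times. *)
Lemma f_fun_surj : `[0, 1] `<=` f_fun p lam @` `[0, 1].
Proof.
move=> y; rewrite /= in_itv /= => /andP[y0 y1].
exists ((1 - y) / lam); last first.
  rewrite f_funE_left; last by rewrite ler_pdivrMr // mulVf ?gt_eqF //; lra.
  by rewrite mulrBr lamV mulrC divfK ?gt_eqF //; lra.
rewrite /= in_itv /= divr_ge0 ?ler_pdivrMr ?(ltW lam0) ?subr_ge0 //=.
by have := lam_gt1; lra.
Qed.

End TheMap.

(** * From covering to mixing on the subtype [0, 1] *)

Theorem proposition3p7 (R : realType) (p : nat) (lam : R)
    (p_ge3 : (3 <= p)%N) (p_odd : odd p) (le_lam : lambda_p R p <= lam) :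
  topologically_mixing (f_map p_ge3 p_odd le_lam).
Proof.
set F := f_map _ _ _ => U V [W oW WU] [x Ux] _ [v Vv].
have /(open_nbhs_nbhs)/nbhs_ballP[e /= e0 ballW] : open_nbhs (\val x) W.
  by split=> //; rewrite -WU in Ux.
(* Half the radius keeps the closed interval inside the open ball; truncating to [0, 1] leaves it
   nondegenerate. *)
pose a : R := Num.max 0 (\val x - e / 2); pose b := Num.min 1 (\val x + e / 2).
have iterF n y : \val (iter n F y) = iter n (f_fun p lam) (\val y).
  by elim: n => //= n <-.
have [/= a0 ab b1 abW] : [/\ 0 <= a, a < b, b <= 1 & `[a, b] `<=` W].
  have := set_valP x; rewrite /unit_itv /= in_itv /= => /andP[x0 x1].
  have e2 : 0 < e / 2 by rewrite divr_gt0.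
  split; rewrite ?le_max ?ge_min ?lexx ?orbT //.
    by rewrite gt_max !lt_min ltr01 /=; apply/and3P; split; lra.
  move=> y; rewrite /= in_itv /= ge_max le_min.
  move=> /andP[/andP[_ y1] /andP[_ y2]].
  apply: ballW; rewrite /ball /= -[sval x]/(\val x) ltr_norml.
  by apply/andP; split; lra.
have [N onN] := f_fun_onto_itv p_ge3 p_odd le_lam a0 ab b1.
exists N => n Nn.
have [z zab zv] : (iter n (f_fun p lam) @` `[a, b]) (\val v).
  suff: `[0, 1] `<=` iter n (f_fun p lam) @` `[a, b] by apply; apply: set_valP.
  rewrite -(subnK Nn); elim: (n - N)%N => // k IHk y.
  move=> /(f_fun_surj p_ge3 le_lam)[y' /IHk[w wab <-] <-].
  by exists w.
have zI : unit_itv R z.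
  by move: zab; rewrite /unit_itv /= !in_itv /= => /andP[*];
     apply/andP; split; lra.
exists v; split => //; exists (SigSub (mem_set zI)).
  by rewrite -WU; apply: abW.
by apply: val_inj; rewrite iterF.
Qed.
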